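(* Let $G$ be a finite, simple, connected graph with radius $r$ and diameter $d$, and suppose $d \le 2r-2$. Then the circumference of $G$ satisfies $c(G) \ge 4r - 2d$; that is, $G$ contains a cycle of length at least $4r-2d$.
   Context: For a connected graph $G$, the distance $d(u,v)$ between vertices $u,v$ is the length of a shortest $u$–$v$ path. The eccentricity of a vertex $u$ is $e(u)=\max\{d(u,v): v \in V(G)\}$. The radius $r(G)$ is the minimum eccentricity over all vertices and the diameter $d(G)$ is the maximum eccentricity over all vertices. The circumference $c(G)$ is the length of a longest cycle in $G$. *)

(* Defs.v *)
(* Plain MathComp: a finite simple graph is a symmetric irreflexive relation
   [e : rel T] on a finite type [T]. *)
From mathcomp Require Import all_boot.

Set Implicit Arguments.
Unset Strict Implicit.
Unset Printing Implicit Defensive.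

Section Graph.
Variables (T : finType) (e : rel T).

(* The vertex set of a connected graph is nonempty. *)
Definition connected_graph : Prop :=
  0 < #|T| /\ forall u v : T, connect e u v.

(* The vertices of the path are [u :: p], so its length is [size p]. *)
Definition is_upath (u v : T) (p : seq T) : bool :=
  [&& path e u p, last u p == v & uniq (u :: p)].

(* A path has fewer than [#|T|] edges, so the default value [#|T|] of the
   minimum is taken only when no path joins [u] to [v]. *)
Definition gdist (u v : T) : nat :=
  \big[minn/#|T|]_(n < #|T| | [exists p : n.-tuple T, is_upath u v p]) n.

Definition ecc (u : T) : nat := \max_(v : T) gdist u v.

(* No eccentricity exceeds [#|T|], so this default does not affect the minimum
   over a nonempty vertex set. *)
Definition radius : nat := \big[minn/#|T|]_(u : T) ecc u.

Definition diameter : nat := \max_(u : T) ecc u.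

(* [ucycleb] also accepts cyclic sequences of fewer than three vertices, such
   as an edge traversed back and forth; these are not cycles of the graph. *)
Definition is_gcycle (c : seq T) : bool := (2 < size c) && ucycleb e c.

(* A cycle has at most [#|T|] vertices; the value is 0 for an acyclic graph. *)
Definition circumference : nat :=
  \max_(n < #|T|.+1 | [exists c : n.-tuple T, is_gcycle c]) n.

End Graph.

(* Main.v *)
(** Choose [x] and [w] at distance at least the radius [r] so that the component
    of [w] in the graph minus [x] is as small as possible, and let [y] be the
    vertex nearest to [x] among the vertices different from [x] that meet every
    path from [x] to [w] ([w] is one of them).  By the choice of [y], no third
    vertex separates [x] from [y].  If [y] is not [w], the component of [w] in
    the graph minus [y] is strictly smaller than the previous one, so every
    vertex at distance at least [r] from [y] is separated from [w] by [y];
    hence [d(y, w) + r <= d].  In all cases [d(x, y) >= r - (d - r) = 2r - d],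
    and two internally disjoint paths from [x] to [y] form the cycle. *)
Require Import Defs.
From mathcomp Require Import all_boot.
From mathcomp Require Import zify.

Set Implicit Arguments.
Unset Strict Implicit.
Unset Printing Implicit Defensive.

(** * Minima over finite types and splitting of sequences *)

Lemma bigminn_le (I : finType) (P : pred I) (F : I -> nat) (m : nat) (i : I) :
  P i -> \big[minn/m]_(j | P j) F j <= F i.
Proof.
move=> Pi; have: i \in index_enum I by rewrite mem_index_enum.
elim: (index_enum I) => // j s IHs; rewrite inE big_cons.
case/orP => [/eqP <-|/IHs le_s]; first by rewrite Pi geq_minl.
by case: ifP => // _; rewrite geq_min le_s orbT.
Qed.

(** Serves to cut a path at its last vertex lying in a given set. *)
Lemma split_last (T : eqType) (a : pred T) (x : T) (s : seq T) :
  a x -> exists s1 s2,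
    [/\ s = s1 ++ s2, a (last x s1) & forall z, z \in s2 -> ~~ a z].
Proof.
elim/last_ind: s => [|s y IHs] ax; first by exists [::], [::].
have [ay|nay] := boolP (a y).
  by exists (rcons s y), [::]; rewrite cats0 last_rcons.
have [s1 [s2 [-> a1 a2]]] := IHs ax.
exists s1, (rcons s2 y); rewrite rcons_cat; split=> // z.
by rewrite mem_rcons inE => /predU1P[->|/a2].
Qed.

(** * Separation by a vertex and pairs of disjoint paths *)

Section Connectivity.
Variables (T : finType) (e : rel T).
Hypothesis e_sym : symmetric e.

(** The graph minus [z], kept on the type [T]: [z] stays as an isolated vertex, still connected to
    itself. *)
Definition avoid (z a b : T) : bool := [&& e a b, a != z & b != z].
Arguments avoid z a b /.

Lemma avoid_sym (z : T) : symmetric (avoid z).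
Proof. by move=> a b; rewrite /= e_sym [(a != z) && _]andbC. Qed.

Lemma connect_avoid_sym (z : T) : connect_sym (avoid z).
Proof. exact/sym_connect_sym/avoid_sym. Qed.

Lemma path_connect_avoid (z x : T) (p : seq T) :
  path e x p -> z \notin x :: p -> connect (avoid z) x (last x p).
Proof.
elim: p x => [|y p IHp] x //= /andP[exy yp] nz.
have nzy : z \notin y :: p by move: nz; rewrite in_cons negb_or => /andP[].
apply: connect_trans (IHp y yp nzy); apply: connect1.
move: nz; rewrite !inE !negb_or => /and3P[zx zy _].
by rewrite /= exy eq_sym zx eq_sym zy.
Qed.

Lemma connect_avoid_path (z x v : T) :
  connect (avoid z) x v -> x != z ->
  exists p, [/\ path e x p, last x p = v, uniq (x :: p) & z \notin x :: p].
Proof.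
move=> /connectP[p0 xp0 ->] xz.
case: (shortenP xp0) => p xp Up _.
exists p; split=> //.
  by apply: sub_path xp => a b /= /andP[].
rewrite inE negb_or eq_sym xz /=.
elim: (p) (x) xp => //= y s IHs a /andP[/and3P[_ _ yz]] /IHs.
by rewrite inE negb_or eq_sym yz.
Qed.

Lemma connect_avoid_target (z x : T) : connect (avoid z) x z -> x = z.
Proof.
move=> xz; apply/eqP; apply: contraT => nxz.
have [p [_ lp _]] := connect_avoid_path xz nxz.
by rewrite -[X in X \notin _]lp mem_last.
Qed.

Lemma path_meets (z x w : T) (p : seq T) :
  ~~ connect (avoid z) x w -> path e x p -> last x p = w -> z \in x :: p.
Proof.
move=> nc xp lp; apply: contraNT nc => nz.
by rewrite -lp; apply: path_connect_avoid.
Qed.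

(** The sequences [p] and [q] omit the start [x], so only [v] has to be excepted; both may be the
    same single edge. *)
Definition disjoint_paths (x v : T) (p q : seq T) : Prop :=
  [/\ is_upath e x v p, is_upath e x v q &
      forall z, z \in p -> z \in q -> z = v].

Lemma disjoint_paths_sym (x v : T) (p q : seq T) :
  disjoint_paths x v p q -> disjoint_paths x v q p.
Proof. by case=> ? ? pq; split=> // z zq zp; apply: pq. Qed.

(** Inductive step of Whitney's argument: [t] is where a path from [x] to [v] avoiding [u] leaves
    [p] and [q] for the last time, here on [p]. One new path follows [p] to [t] and then [r]; the
    other follows [q] to [u] and takes the edge to [v]. *)
Lemma reroute (x u v t : T) (p q r : seq T) :
  disjoint_paths x u p q -> e u v -> v != x -> v != u ->
  t \in x :: p -> u != t ->
  path e t r -> last t r = v -> uniq r ->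
  (forall z, z \in r -> z \notin x :: p ++ q) ->
  exists p' q', disjoint_paths x v p' q'.
Proof.
move=> [] /and3P[xp /eqP lp Up] /and3P[xq /eqP lq Uq] pq euv vx vu.
move=> tp ut tr lr Ur rS.
case/splitPl: tp xp lp Up pq rS => p1 p2 lp1 xp lp Up pq rS.
rewrite cat_path lp1 in xp; case/andP: xp => xp1 tp2.
rewrite last_cat lp1 in lp.
have up2 : u \in p2.
  case: p2 lp {tp2 pq rS Up} => [/= tu|a p2 /= <-]; last exact: mem_last.
  by rewrite tu eqxx in ut.
have up1 : u \notin p1.
  move: Up; rewrite /= cat_uniq => /andP[_ /and3P[_ /hasPn h _]].
  exact: (h u up2).
(* If [r] is empty, then [t = v] lies on [p], and disjointness would give [v = u]; otherwise [v]
   ends [r], off both paths. *)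
have vq : v \notin q.
  case: r {tr Ur} lr rS => [/= tv _|a r /= lr rS].
    have: v \in x :: p1 by rewrite -tv -lp1 mem_last.
    rewrite inE (negPf vx) /= => vp1; apply: contra vu => vq.
    by apply/eqP; apply: pq; rewrite ?mem_cat ?vp1.
  have /rS : v \in a :: r by rewrite -lr mem_last.
  by rewrite !inE !mem_cat !negb_or => /and3P[].
exists (p1 ++ r), (rcons q v); split.
- rewrite /is_upath cat_path lp1 xp1 tr last_cat lp1 lr eqxx /=.
  move: Up; rewrite /= mem_cat negb_or cat_uniq => /andP[/andP[xp1' _]].
  case/and3P=> Up1 _ _; rewrite mem_cat (negPf xp1') cat_uniq Up1 Ur /= andbT.
  apply/andP; split.
    by apply/negP => /rS; rewrite inE eqxx.
  by apply/hasPn => z /rS; rewrite !inE !mem_cat !negb_or -!andbA => /and4P[].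
- rewrite /is_upath rcons_path xq lq euv last_rcons eqxx /=.
  rewrite mem_rcons inE negb_or eq_sym vx rcons_uniq vq /=.
  by move: Uq.
- move=> z; rewrite mem_cat mem_rcons inE => zpr /predU1P[//|zq].
  case/orP: zpr => [zp1|/rS]; last first.
    by rewrite inE !mem_cat zq !orbT.
  by move: up1; rewrite -(pq z) ?mem_cat ?zp1.
Qed.

(* Menger's theorem for two paths, by induction along any path from [x] to [v]
   as in Whitney's proof; for adjacent vertices both paths may be the edge. *)
Lemma two_disjoint_paths (x v : T) (s : seq T) :
  path e x s -> last x s = v -> uniq (x :: s) -> x != v ->
  (forall z, z != x -> z != v -> connect (avoid z) x v) ->
  exists p q, disjoint_paths x v p q.
Proof.
elim/last_ind: s v => [|s y IHs] v; first by move=> _ /= -> _; rewrite eqxx.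
rewrite rcons_path last_rcons => /andP[xs eu] <-{v}.
rewrite -rcons_cons rcons_uniq => /andP[ys Us] xy xyP.
set u := last x s in eu.
have yu : y != u by apply: contraNneq ys => ->; apply: mem_last.
have [ux|ux] := eqVneq u x.
  exists [:: y], [:: y]; rewrite ux in eu.
  have ups : is_upath e x y [:: y].
    by rewrite /is_upath /= eu eqxx inE xy.
  by split=> // z; rewrite inE => /eqP.
(* Non-separation passes from [y] to [u]: for [z = y] the path [s] misses [y]; for any other [z],
   append the edge from [y] to [u]. *)
have [||p [q pq]] := IHs u xs erefl Us; first by rewrite eq_sym.
  move=> z zx zu; have [->|zy] := eqVneq z y.
    exact: path_connect_avoid.
  apply: connect_trans (xyP z zx zy) _; apply: connect1.
  by rewrite /= e_sym eu eq_sym zy eq_sym zu.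
have uy : u != y by rewrite eq_sym.
have xu : x != u by rewrite eq_sym.
have [r [xr lr Ur nur]] := connect_avoid_path (xyP u ux uy) xu.
(* The last vertex of [r] on the two old paths; the roles of [p] and [q] are swapped if it is not on
   [p]. *)
have [|r1 [r2 [rE r1S r2S]]] :=
  @split_last _ (mem (x :: p ++ q)) x r; first by rewrite /= inE eqxx.
rewrite rE cat_path in xr; case/andP: xr => xr1 r1r2.
rewrite rE last_cat in lr.
have Ur2 : uniq r2.
  by move: Ur; rewrite rE /= cat_uniq => /andP[_ /and3P[]].
have ut : u != last x r1.
  apply: contraNneq nur => ->; rewrite rE -cat_cons mem_cat.
  by rewrite mem_last.
have yx : y != x by rewrite eq_sym.
have [tp|tp] := boolP (last x r1 \in x :: p).
  exact: reroute pq eu yx yu tp ut r1r2 lr Ur2 r2S.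
have tq : last x r1 \in x :: q.
  by move: r1S tp; rewrite !inE mem_cat; do 2!case: (_ \in _); rewrite ?orbT.
apply: reroute (disjoint_paths_sym pq) eu yx yu tq ut r1r2 lr Ur2 _.
move=> z /r2S /=; rewrite !inE !mem_cat.
by rewrite [(z \in p) || _]orbC.
Qed.

(** Follow [p], then [q] backwards without its endpoint [v]. The size condition rules out two copies
    of a single edge. *)
Lemma disjoint_paths_cycle (x v : T) (p q : seq T) :
  disjoint_paths x v p q -> x != v -> 2 < size p + size q ->
  exists c, is_gcycle e c /\ size c = size p + size q.
Proof.
move=> [] /and3P[xp /eqP lp Up] /and3P[xq /eqP lq Uq] pq xv sz.
elim/last_ind: q => [|q y _] in xq lq Uq pq sz *.
  by rewrite -lq eqxx in xv.
rewrite last_rcons in lq; subst y.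
exists (x :: p ++ rev q).
have szE : size (x :: p ++ rev q) = size p + size (rcons q v).
  by rewrite /= size_cat size_rev size_rcons addnS.
split=> //; rewrite /is_gcycle szE sz /= /ucycleb; apply/andP; split.
  rewrite /= rcons_cat cat_path xp lp -rev_cons.
  have := rev_path e x (rcons q v); rewrite last_rcons belast_rcons => ->.
  by rewrite (eq_path (e' := e)) // => a b; apply: e_sym.
move: Up Uq; rewrite /= mem_rcons inE negb_or rcons_uniq.
move=> /andP[xp' Up] /andP[/andP[_ xq'] /andP[vq Uq]].
rewrite mem_cat mem_rev negb_or xp' xq' cat_uniq Up rev_uniq Uq /= andbT.
apply/hasPn => z; rewrite mem_rev => zq; apply/negP => zp.
move: vq; rewrite -(pq z zp) ?zq //.
by rewrite mem_rcons inE zq orbT.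
Qed.

End Connectivity.

(** * Distances and the choice of the pair of vertices *)

Section Distance.
Variables (T : finType) (e : rel T).
Hypothesis e_sym : symmetric e.
Hypothesis e_conn : connected_graph e.

Lemma gdist_le_upath (u v : T) (p : seq T) :
  is_upath e u v p -> gdist e u v <= size p.
Proof.
move=> up; have ltp : size p < #|T|.
  by case/and3P: up => _ _ Up; apply: leq_trans (max_card (mem (u :: p)));
     rewrite (card_uniqP Up).
rewrite /gdist; apply: (@bigminn_le _ _ (fun n : 'I__ => n : nat) _ (Ordinal ltp)).
by apply/existsP; exists (in_tuple p).
Qed.

Lemma gdist_le_path (u v : T) (p : seq T) :
  path e u p -> last u p = v -> gdist e u v <= size p.
Proof.
move=> up <-; case: (shortenP up) => q uq Uq /(uniq_leq_size _) sub.
apply: leq_trans (sub _); last by case/andP: Uq.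
by apply: gdist_le_upath; rewrite /is_upath uq eqxx.
Qed.

(** Connectivity provides a simple path, of length below [#|T|], so the minimum is attained by a
    path and not by the default value. *)
Lemma geodesic (u v : T) :
  exists p, [/\ path e u p, last u p = v, uniq (u :: p) & size p = gdist e u v].
Proof.
have [p0 up0] : exists p, is_upath e u v p.
  case/connectP: (e_conn.2 u v) => p up ->.
  case: (shortenP up) => q uq Uq _.
  by exists q; rewrite /is_upath uq eqxx.
have ltd : gdist e u v < #|T|.
  apply: leq_ltn_trans (gdist_le_upath up0) _.
  by case/and3P: up0 => _ _ Up; apply: leq_trans (max_card (mem (u :: p0)));
     rewrite (card_uniqP Up).
have : gdist e u v = #|T| \/ exists p, is_upath e u v p /\ size p = gdist e u v.
  apply: (big_ind (fun n => n = #|T| \/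
                     exists p, is_upath e u v p /\ size p = n)).
  - by left.
  - by move=> m n; case: (leqP m n).
  - by move=> i /existsP[p up]; right; exists p; rewrite size_tuple.
case=> [E|[p [/and3P[? /eqP ? ?] ?]]]; first by rewrite E ltnn in ltd.
by exists p.
Qed.

Lemma gdist_sym_le (u v : T) : gdist e v u <= gdist e u v.
Proof.
have [p [up lp _ <-]] := geodesic u v.
rewrite -(size_belast u p) -size_rev; apply: gdist_le_path; last first.
  by case: p {up} lp => [//|y p] _; rewrite /= rev_cons last_rcons.
by rewrite -lp rev_path (eq_path (e' := e)) // => a b; apply: e_sym.
Qed.

Lemma gdistC (u v : T) : gdist e u v = gdist e v u.
Proof. by apply/eqP; rewrite eqn_leq !gdist_sym_le. Qed.

Lemma gdist_triangle (u v w : T) :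
  gdist e u w <= gdist e u v + gdist e v w.
Proof.
have [p [up lp _ <-]] := geodesic u v; have [q [vq lq _ <-]] := geodesic v w.
rewrite -size_cat; apply: gdist_le_path; last by rewrite last_cat lp.
by rewrite cat_path up lp.
Qed.

Lemma gdist_eq0 (u v : T) : gdist e u v = 0 -> u = v.
Proof. by have [p [_ <- _ <-]] := geodesic u v; move/size0nil ->. Qed.

(** A geodesic from [u] to [v] must pass through [z]; cut it there. *)
Lemma gdist_through (u v z : T) :
  ~~ connect (avoid e z) u v -> gdist e u z + gdist e z v <= gdist e u v.
Proof.
move=> nc; have [p [up lp _ <-]] := geodesic u v.
have zp := path_meets nc up lp.
case/splitPl: zp up lp => p1 p2 lp1; rewrite cat_path last_cat lp1 size_cat.
by case/andP=> up1 zp2 lp2; apply: leq_add; apply: gdist_le_path.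
Qed.

Lemma gdist_le_diameter (u v : T) : gdist e u v <= diameter e.
Proof.
apply: leq_trans (leq_bigmax u).
exact: (leq_bigmax (F := fun v => gdist e u v) v).
Qed.

Lemma far_vertex (u : T) : exists w, radius e <= gdist e u w.
Proof.
have [w wE] := @eq_bigmax T (fun w => gdist e u w) e_conn.1.
by exists w; rewrite -wE; apply: (@bigminn_le _ _ (ecc e)).
Qed.

Lemma far_unseparated_pair :
  diameter e < 2 * radius e ->
  exists x y, [/\ x != y, 2 * radius e <= diameter e + gdist e x y &
    forall z, z != x -> z != y -> connect (avoid e z) x y].
Proof.
move=> d_lt.
case/card_gt0P: (e_conn.1) => x0 _; have [w0 xw0] := far_vertex x0.
pose far (a : T * T) := radius e <= gdist e a.1 a.2.
pose comp (a : T * T) := #|connect (avoid e a.1) a.2|.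
case: (@arg_minnP _ (x0, w0) far comp xw0) => -[x w]; rewrite /far /comp /=.
move=> far_xw min_xw.
(* The bound on the diameter forces a positive radius. *)
have xw : x != w.
  apply: contraTneq far_xw => <-.
  have : gdist e x x <= 0 by apply: (@gdist_le_path x x [::]).
  lia.
pose sep y := (y != x) && ~~ connect (avoid e y) x w.
have sepw : sep w.
  rewrite /sep eq_sym xw; apply: contra xw => /connect_avoid_target ->.
  exact: eqxx.
case: (@arg_minnP _ w sep (fun y => gdist e x y) sepw) => y.
rewrite /sep => /andP[yx nc_y] min_y.
exists x, y; split; first by rewrite eq_sym.
- have [->|yw] := eqVneq y w.
    by move: (gdist_le_diameter x w) far_xw; lia.
  (* A path from [w] missing [y] cannot meet [x], since [y] separates [x] from [w]. *)
  have sub : forall a, connect (avoid e y) w a -> connect (avoid e x) w a.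
    move=> a wa; have wy : w != y by rewrite eq_sym.
    have [p [wp lp _ ynp]] := connect_avoid_path wa wy.
    rewrite -lp; apply: path_connect_avoid => //; apply: contra nc_y => xp.
    rewrite connect_avoid_sym //.
    case/splitPl: xp wp ynp {lp} => p1 p2 lp1.
    rewrite cat_path -cat_cons mem_cat negb_or => /andP[wp1 _] /andP[yp1 _].
    by rewrite -lp1; apply: path_connect_avoid.
  (* Strictness comes from [y] itself: the tail of a geodesic from [x] to [w] joins it to [w] off
     [x]. *)
  have lt_comp : comp (y, w) < comp (x, w).
    apply/proper_card/properP; split; first exact/subsetP.
    exists y.
      have [p [xp lp Up _]] := geodesic x w.
      have yp := path_meets nc_y xp lp.
      rewrite inE (negPf yx) /= in yp.
      rewrite -[_ \in _]/(connect (avoid e x) w y) connect_avoid_sym //.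
      case/splitPr: yp xp lp Up => p1 p2.
      rewrite cat_path last_cat /= => /and3P[_ _ yp2] <-.
      rewrite mem_cat negb_or => /andP[/andP[_ xp2] _].
      exact: path_connect_avoid.
    by apply: contra yw => wy; apply/eqP/esym/(connect_avoid_target wy).
  have [w' yw'] := far_vertex y.
  (* Otherwise [(y, w')] would be a far pair with a smaller component than [(x, w)]. *)
  have sep_w' : ~~ connect (avoid e y) w w'.
    apply/negP => ww'.
    have := min_xw (y, w') yw'; rewrite leqNgt => /negP; apply => /=.
    rewrite (_ : #|_| = comp (y, w)) //; apply: eq_card => a.
    exact/esym/(same_connect (connect_avoid_sym e_sym y) ww').
  (* Hence $d(y,w) \le d-r$, while $r \le d(x,w) \le d(x,y)+d(y,w)$. *)
  move: (gdist_through sep_w') (gdist_le_diameter w w') (gdist_triangle x y w).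
  rewrite (gdistC w y); lia.
- move=> z zx zy; apply: contraT => nc_z.
  (* A path from [x] to [w] avoiding [z] would pass through [y], and its part up to [y] would join
     [x] to [y]. *)
  have sep_z : ~~ connect (avoid e z) x w.
    apply: contra nc_z => xw_z; have xz : x != z by rewrite eq_sym.
    have [p [xp lp _ znp]] := connect_avoid_path xw_z xz.
    have yp := path_meets nc_y xp lp.
    case/splitPl: yp xp znp {lp} => p1 p2 lp1.
    rewrite cat_path -cat_cons mem_cat negb_or => /andP[xp1 _] /andP[zp1 _].
    by rewrite -lp1; apply: path_connect_avoid.
  (* So [z] competes with [y] for nearness to [x], yet lies on a geodesic from [x] to [y]; this
     leaves only [z = y]. *)
  have le_yz : gdist e x y <= gdist e x z by apply: min_y; rewrite zx.
  have zy0 : gdist e z y = 0 by move: (gdist_through nc_z) le_yz; lia.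
  by rewrite (gdist_eq0 zy0) eqxx in zy.
Qed.

End Distance.

(** * The long cycle and the circumference *)

Lemma gcycle_le_circumference (T : finType) (e : rel T) (c : seq T) :
  is_gcycle e c -> size c <= circumference e.
Proof.
move=> cc; have lec : size c < #|T|.+1.
  by case/andP: cc => _ /andP[_ /card_uniqP <-]; rewrite ltnS max_card.
apply: (@leq_bigmax_cond _ _ (fun n : 'I__ => n : nat) (Ordinal lec)).
by apply/existsP; exists (in_tuple c).
Qed.

Unset Implicit Arguments.
Set Strict Implicit.

Theorem theorem1 (T : finType) (e : rel T)
    (e_sym : symmetric e) (e_irr : irreflexive e)
    (e_conn : connected_graph e)
    (d_le : diameter e + 2 <= 2 * radius e) :
  4 * radius e - 2 * diameter e <= circumference e /\
  exists c : seq T,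
    is_gcycle e c /\ 4 * radius e - 2 * diameter e <= size c.
Proof.
have [|x [y [xy far_xy xyP]]] := far_unseparated_pair e_sym e_conn.
  by lia.
have [s [xs ls Us _]] := geodesic e_conn x y.
have [p [q pq]] := two_disjoint_paths e_sym xs ls Us xy xyP.
have [up uq _] := pq.
(* Each path has length at least $d(x,y) \ge 2r-d \ge 2$, so the two together have more than two
   edges and at least $2(2r-d)$. *)
have [|c [cc sc]] := disjoint_paths_cycle e_sym pq xy.
  by move: (gdist_le_upath up) (gdist_le_upath uq); lia.
have le_c : 4 * radius e - 2 * diameter e <= size c.
  by move: (gdist_le_upath up) (gdist_le_upath uq); lia.
split; last by exists c.
exact: leq_trans le_c (gcycle_le_circumference cc).
Qed.
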